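(* Let $p\ge1$ be an integer, $H>0$, $\beta\in[0,1/p]$ with $\beta<1$, and $x_0\in\mathrm{dom}\,\psi$. Let $\{x_k\}_{k\ge0}$ be a sequence generated by the inexact high-order proximal-point method, i.e. for every $k\ge0$ there is $g_{k+1}\in\partial\psi(x_{k+1})$ with $$(x_{k+1},g_{k+1})\in\mathcal{A}_H^p(x_k,\beta).$$ Assume $D_0=\max_{x\in\mathrm{dom}\,\psi}\{\|x-x^*\|:F(x)\le F(x_0)\}<+\infty$. Then, for all $k\ge1$, $$F(x_k)-F^*\le\frac12\left(\frac{1}{1-\beta}HD_0^{p+1}+F(x_0)-F^*\right)\left(\frac{2p+2}{k}\right)^p.$$
   Context: $\mathbb{E}$ is a finite-dimensional real vector space with dual $\mathbb{E}^*$; $B:\mathbb{E}\to\mathbb{E}^*$ is a self-adjoint positive-definite operator, $\|x\|=\langle Bx,x\rangle^{1/2}$ on $\mathbb{E}$ and $\|g\|_*=\langle g,B^{-1}g\rangle^{1/2}$ on $\mathbb{E}^*$. $d_{p+1}(x)=\frac{1}{p+1}\|x\|^{p+1}$. $f:\mathbb{E}\to\mathbb{R}$ is convex and differentiable, $\psi:\mathbb{E}\to\mathbb{R}\cup\{+\infty\}$ is proper closed convex with effective domain $\mathrm{dom}\,\psi$, and $F=f+\psi$. The problem $\min_{x\in\mathrm{dom}\,\psi}F(x)$ has an optimal solution $x^*\in\mathrm{dom}\,\psi$, fixed throughout, and $F^*=F(x^* )$. For $\bar x\in\mathbb{E}$, let $f_{\bar x,H}^p(x)=f(x)+H\,d_{p+1}(x-\bar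 x)$ and $$\mathcal{A}_H^p(\bar x,\beta)=\{(x,g)\in\mathrm{dom}\,\psi\times\mathbb{E}^*:\ g\in\partial\psi(x),\ \|\nabla f_{\bar x,H}^p(x)+g\|_*\le\beta\|\nabla f(x)+g\|_*\}.$$ *)

(* Defs.v *)
From HB Require Import structures.
From mathcomp Require Import all_boot all_order all_algebra.
From mathcomp Require Import all_classical all_reals all_analysis.

Set Implicit Arguments.
Unset Strict Implicit.
Unset Printing Implicit Defensive.

Import Order.TTheory GRing.Theory Num.Theory.
Import numFieldNormedType.Exports.

Local Open Scope classical_set_scope.
Local Open Scope ring_scope.

(* Finite-dimensional normed spaces. The norm [`|x|] carried by the structure
   only provides the topology used by the library's [differentiable], ['d] and
   [closed]. It is unrelated to the Euclidean norm [pnorm B] below; in finite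
   dimension all norms induce the same topology. *)
#[short(type="finNormedModType")]
HB.structure Definition FinNormedModule (R : numFieldType) :=
  {E of NormedModule R E & Vector R E}.

Section Defs.
Context {R : realType} {E : finNormedModType R}.

(* The duality pairing <g, x> is the application [g x]. *)
Definition dual : Type := 'Hom(E, R^o).

Implicit Types (B : 'Hom(E, dual)) (f : E -> R) (psi : E -> \bar R).

Definition self_adjoint B := forall x y : E, (B x : dual) y = (B y : dual) x.

Definition positive_definite B := forall x : E, x != 0 -> 0 < (B x : dual) x.

Definition pnorm B (x : E) : R := Num.sqrt ((B x : dual) x).

(* [(B^-1)%VF] is the inverse of [B] as soon as [B] is injective, since [E] and
   its dual have the same dimension. *)
Definition dnorm B (g : dual) : R := Num.sqrt (g ((B^-1)%VF g)).

Definition prox_fun B (q : nat) (x : E) : R := q%:R^-1 * pnorm B x ^+ q.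

(* The differential, as an element of the dual; meaningful where [f] is
   differentiable. *)
Definition grad f (x : E) : dual := linfun ('d f x : E -> R^o).

Definition edom psi : set E := [set x | (psi x < +oo)%E].

Definition epigraph psi : set (E * R^o) := [set z | (psi z.1 <= z.2%:E)%E].

Definition proper_fun psi :=
  (forall x, psi x != -oo%E) /\ exists x, edom psi x.

Definition closed_fun psi := closed (epigraph psi).

Definition convex_efun psi := convex_set (epigraph psi).

Definition subdiff psi (x : E) : set dual :=
  [set g | forall y, (psi x + (g (y - x))%:E <= psi y)%E].

Definition reg_fun B f (p : nat) (H : R) (xbar x : E) : R :=
  f x + H * prox_fun B p.+1 (x - xbar).

Definition acceptable B f psi (p : nat) (H : R) (xbar : E) (beta : R) :
    set (E * dual) :=
  [set z | [/\ edom psi z.1, subdiff psi z.1 z.2 &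
    dnorm B (grad (reg_fun B f p H xbar) z.1 + z.2)
      <= beta * dnorm B (grad f z.1 + z.2)]].

Definition objective f psi (x : E) : \bar R := ((f x)%:E + psi x)%E.

Definition level_radius B f psi (xs x0 : E) : \bar R :=
  ereal_sup [set (pnorm B (x - xs))%:E | x in
    [set x | edom psi x /\ (objective f psi x <= objective f psi x0)%E]].

End Defs.
Arguments dual {R} E.

(* Main.v *)
Require Import Defs.
From HB Require Import structures.
From mathcomp Require Import all_boot all_order all_algebra.
From mathcomp Require Import all_classical all_reals all_analysis.
From mathcomp Require Import ring lra.
Import Order.TTheory GRing.Theory Num.Theory.
Import numFieldNormedType.Exports.
Import VectorInternalTheory.
Local Open Scope classical_set_scope.
Local Open Scope ring_scope.

(** Write G_k for the element grad f (x_(k+1)) + g_(k+1) of the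
    subdifferential of F = f + psi at x_(k+1), a_k for its dual norm and r_k
    for the length of the step d_k = x_(k+1) - x_k. The gradient of the
    regularizer H d_(p+1)(. - x_k) at x_(k+1) is H r_k^(p-1) B d_k
    ([grad_reg_fun]), so acceptability reads
    |G_k + H r_k^(p-1) B d_k|_* <= beta a_k.

    Squaring this inequality bounds <G_k, x_k - x_(k+1)> below by a function
    of r_k, while r_k^p >= (1 - beta) a_k / H =: s_k^p. The condition
    beta <= 1/p makes that function at least its value at r_k = s_k, which is
    a_k s_k ([prox_step_decrease], whose scalar core is [prox_scalar_ge]).

    Let delta_k = F(x_k) - F^*. By convexity ([objective_subgradient]),
    delta_k - delta_(k+1) >= a_k s_k. Hence F decreases, the iterates stay in
    the initial level set, and Cauchy-Schwarz gives
    delta_(k+1) <= a_k D_0. Eliminating a_k and s_k,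
    with C = H D_0^(p+1) / (1 - beta) and u_k = (delta_k / C)^(1/p), yields
    u_(k+1)^p (1 + u_(k+1)) <= u_k^p. By Bernoulli, 1 / u_k then grows by at
    least 1 / (p (1 + u_0)) at every step, so k u_k <= p (1 + u_0)
    ([power_recurrence_rate]). Raising this to the power p and using
    (1 + u_0)^p <= 2^(p-1) (1 + u_0^p) gives the announced bound
    ([inexact_descent_rate]).

    The gradient of the regularizer is a Frechet derivative with respect to
    the norm that carries the topology of E, whereas the regularizer is built
    on the Euclidean norm of B. The two are compared by bounding coordinates
    through compactness of the unit sphere ([coord_bounded]). *)

(** * Scalar inequalities and the rate of the recurrence *)

Lemma bernoulli_sub (R : realDomainType) (t : R) (n : nat) :
  t <= 1 -> 1 - n%:R * t <= (1 - t) ^+ n.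
Proof.
move=> t1; elim: n => [|n IH]; first by rewrite expr0 mul0r subr0.
have h : (1 - t) * (1 - n%:R * t) <= (1 - t) ^+ n.+1.
  by rewrite exprS ler_wpM2l // subr_ge0.
apply: le_trans h; rewrite -natr1.
have := mulr_ge0 (ler0n R n) (sqr_ge0 t); nra.
Qed.

(** Equality holds at t = 1. The induction multiplies the inequality by t; what
    remains is (t - 1) (t^(m+1) (t + 1) - 2), nonnegative for t >= 1. *)
Lemma expr_gap2_ge (R : realDomainType) (t : R) (m : nat) :
  1 <= t -> m.+2%:R * t ^+ m <= m%:R * t ^+ m.+2 + 2.
Proof.
move=> t1; elim: m => [|m IH]; first by rewrite expr0 mul0r mulr1 add0r.
have t0 : 0 <= t by lra.
have IHt := ler_wpM2l t0 IH.
have tm : 1 <= t ^+ m.+1 by apply: exprn_ege1.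
have h : 0 <= (t - 1) * (t ^+ m.+1 * (t + 1) - 2).
  by rewrite mulr_ge0 ?subr_ge0 //; nra.
have -> : m.+3%:R = m%:R + 3 :> R by rewrite -addn3 natrD.
have -> : m.+1%:R = m%:R + 1 :> R by rewrite -natr1.
have e2 : m.+2%:R = m%:R + 2 :> R by rewrite -addn2 natrD.
rewrite e2 in IHt; move: IHt h; rewrite !exprS; set y := t ^+ m; set z := m%:R.
move=> IHt h; nra.
Qed.

(** With p = m + 1 and t = r / s, this says that the lower bound on the decrease
    obtained from a step of length r is smallest, among r >= s, at r = s. The
    right-hand side decreases in b, so b = 1/p is the critical case, where the
    inequality becomes m t^(2m+2) + m + 2 >= 2 (m+1) t^m. *)
Lemma prox_scalar_ge (R : realFieldType) (t b : R) (m : nat) :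
  1 <= t -> b * m.+1%:R <= 1 ->
  2 * t ^+ m <= (1 + b) + (1 - b) * t ^+ (m.+1 + m.+1).
Proof.
move=> t1 bm.
have tm : 1 <= t ^+ m by apply: exprn_ege1.
have tm2 : 1 <= t ^+ m.+2 by apply: exprn_ege1.
have g := @expr_gap2_ge R t m t1.
have P0 : 0 < m.+1%:R :> R by rewrite ltr0n.
have -> : (m.+1 + m.+1 = m.+2 + m)%N by rewrite !addSn !addnS.
rewrite exprD; move: tm tm2 g bm P0.
have -> : m.+1%:R = m%:R + 1 :> R by rewrite -natr1.
have -> : m.+2%:R = m%:R + 2 :> R by rewrite -addn2 natrD.
set y := t ^+ m; set w := t ^+ _; set z := m%:R.
move=> y1 w1 g bm P0.
have z0 : 0 <= z by rewrite ler0n.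
rewrite -(ler_pM2l P0).
have h1 : b * (z + 1) * (w * y - 1) <= w * y - 1.
  by rewrite ler_piMl // subr_ge0; nra.
(* With w = t^(m+2), y = t^m, z = m: this turns [g] into
   z (w y - y) >= z (w - 1) >= (z + 2) (y - 1). *)
have h2 : z * (w - 1) * (y - 1) >= 0 by rewrite !mulr_ge0 ?subr_ge0.
nra.
Qed.

(** Midpoint convexity of the (n+1)-st power, at the points 1 and u; the
    inductive step is Chebyshev's inequality (1 - u) (1 - u^(n+1)) >= 0. *)
Lemma exprD1_le (R : realDomainType) (u : R) (n : nat) :
  0 <= u -> (1 + u) ^+ n.+1 <= 2 ^+ n * (1 + u ^+ n.+1).
Proof.
move=> u0; elim: n => [|n IH]; first by rewrite expr0 !expr1 mul1r.
have v0 : 0 <= u ^+ n.+1 by rewrite exprn_ge0.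
have h : 0 <= (1 - u) * (1 - u ^+ n.+1).
  have [u1|/ltW u1] := leP u 1.
    by rewrite mulr_ge0 // subr_ge0 // exprn_ile1.
  by rewrite -mulrNN mulr_ge0 // opprB subr_ge0 // exprn_ege1.
rewrite exprS; apply: le_trans (ler_wpM2l _ IH) _; first by lra.
rewrite [u ^+ n.+2]exprS (exprS 2 n) mulrCA [2 * _]mulrC -mulrA.
rewrite ler_wpM2l ?exprn_ge0 //; nra.
Qed.

Lemma exists_nth_root (R : realType) (n : nat) (a : R) :
  (0 < n)%N -> 0 <= a -> exists2 s, 0 <= s & s ^+ n = a.
Proof.
move=> n0 a0; exists (a `^ n%:R^-1); first exact: powR_ge0.
by rewrite -powR_mulrn ?powR_ge0 // -powRrM mulVf ?powRr1 // pnatr_eq0 -lt0n.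
Qed.

(** For v w > 0 this is 1/v - 1/w >= 1 / (p (1 + v)), freed of its
    denominators: Bernoulli gives (1 + v)^(-1/p) <= 1 - v / (p (1 + v)). *)
Lemma power_recurrence_step (R : realFieldType) (p : nat) (w v : R) :
  (0 < p)%N -> 0 <= w -> 0 <= v -> v ^+ p * (1 + v) <= w ^+ p ->
  v * w <= p%:R * (1 + v) * (w - v).
Proof.
move=> p0 w0 v0 hvw.
have P0 : 0 < p%:R * (1 + v) by rewrite mulr_gt0 ?ltr0n //; lra.
have P1 : 1 <= p%:R :> R by rewrite ler1n.
pose t := v / (p%:R * (1 + v)).
have t1 : t <= 1 by rewrite /t ler_pdivrMr // mul1r; nra.
suff h : v <= w * (1 - t).
  have := ler_wpM2l (ltW P0) h.
  rewrite mulrCA mulrBr mulr1 [_ * t]mulrC divfK ?gt_eqF //; lra.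
rewrite -(@ler_pXn2r _ p) // ?nnegrE ?mulr_ge0 ?subr_ge0 //.
rewrite exprMn; have B := bernoulli_sub R t p t1.
have e : (1 - p%:R * t) = (1 + v)^-1.
  rewrite /t; field; rewrite pnatr_eq0 -lt0n p0 /=; lra.
rewrite e in B.
apply: le_trans (ler_wpM2l _ B); last by rewrite exprn_ge0.
by rewrite ler_pdivlMr //; lra.
Qed.

(** Each step increases 1 / u_k by at least 1 / (p (1 + u_0)), since u is
    nonincreasing. *)
Lemma power_recurrence_rate (R : realFieldType) (p : nat) (u : nat -> R) :
  (0 < p)%N -> (forall k, 0 <= u k) ->
  (forall k, u k.+1 ^+ p * (1 + u k.+1) <= u k ^+ p) ->
  forall k, k%:R * u k <= p%:R * (1 + u 0%N).
Proof.
move=> p0 u0 hu.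
have P0 : 0 < p%:R :> R by rewrite ltr0n.
have dec k : u k.+1 <= u k.
  rewrite -(@ler_pXn2r _ p) // ?nnegrE //; apply: le_trans (hu k).
  by rewrite ler_peMr ?exprn_ge0 // lerDl.
have ub k : u k <= u 0%N by elim: k => // k; exact/le_trans/dec.
elim=> [|k IH]; first by rewrite mul0r mulr_ge0 ?ler0n ?addr_ge0.
have [w0|wn0] := eqVneq (u k) 0.
  have -> : u k.+1 = 0 by apply/eqP; rewrite eq_le u0 andbT -w0.
  by rewrite mulr0 mulr_ge0 ?ler0n ?addr_ge0.
have w0 : 0 < u k by rewrite lt0r wn0 u0.
have h := @power_recurrence_step R p _ _ p0 (u0 k) (u0 k.+1) (hu k).
have h1 : p%:R * (1 + u k.+1) * (u k - u k.+1) <=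
          p%:R * (1 + u 0%N) * (u k - u k.+1).
  by rewrite ler_wpM2r ?subr_ge0 // ler_wpM2l ?(ltW P0) ?lerD2l.
have h2 := ler_wpM2l (u0 k.+1) IH.
rewrite -(ler_pM2r w0) -natr1; nra.
Qed.

(** Here d k is the functional gap, a k the dual norm of the subgradient and
    s k the scale of the step it forces. Rescaling the gap by
    C = H D^(p+1) / (1 - b) makes all constants of the resulting recurrence
    equal to 1. *)
Lemma inexact_descent_rate (R : realType) (p : nat) (H b D : R)
  (d a s : nat -> R) :
  (0 < p)%N -> 0 < H -> b < 1 -> 0 <= D ->
  (forall k, 0 <= d k) -> (forall k, 0 <= a k) -> (forall k, 0 <= s k) ->
  (forall k, H * s k ^+ p = (1 - b) * a k) ->
  (forall k, a k * s k <= d k - d k.+1) ->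
  (forall k, d k.+1 <= a k * D) ->
  forall k, (0 < k)%N ->
  d k <= 2^-1 * ((1 - b)^-1 * H * D ^+ p.+1 + d 0%N)
         * ((2 * p + 2)%:R / k%:R) ^+ p.
Proof.
move=> p0 H0 b1 D0 d0 a0 s0 hs hdec hub k k0.
have b0 : 0 < 1 - b by rewrite subr_gt0.
have r0 : 0 <= ((2 * p + 2)%:R / k%:R : R) ^+ p.
  by rewrite exprn_ge0 // divr_ge0.
(* The rescaling divides by D; when D = 0 the gap vanishes from k = 1 on. *)
have [Dz|Dn0] := eqVneq D 0.
  case: k k0 r0 => // k _ r0; apply: le_trans (hub k) _.
  rewrite Dz mulr0 !mulr_ge0 ?invr_ge0 // addr_ge0 //.
  by rewrite !mulr_ge0 ?exprn_ge0 ?invr_ge0 ?(ltW b0) ?(ltW H0).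
have {D0}D0 : 0 < D by rewrite lt0r Dn0.
set C := (1 - b)^-1 * H * D ^+ p.+1.
have C0 : 0 < C by rewrite !mulr_gt0 ?invr_gt0 ?exprn_gt0.
have [u hu0 hu] : exists2 u : nat -> R, (forall k, 0 <= u k) &
    forall k, u k ^+ p = d k / C.
  have /choice[u hu] : forall k, exists u, 0 <= u /\ u ^+ p = d k / C.
    move=> j; have [||v] := @exists_nth_root R p (d j / C) => //.
      by rewrite divr_ge0 // ltW.
    by exists v.
  by exists u => j; have [] := hu j.
have aE j : a j = H * s j ^+ p / (1 - b).
  by rewrite hs mulrC mulKf ?gt_eqF.
have us j : u j.+1 <= s j / D.
  rewrite -(@ler_pXn2r _ p) // ?nnegrE ?divr_ge0 ?(ltW D0) //.
  rewrite hu ler_pdivrMr //; apply: le_trans (hub j) _.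
  rewrite aE /C expr_div_n exprS le_eqVlt; apply/orP; left; apply/eqP.
  by field; rewrite ?expf_neq0 ?gt_eqF.
have rec j : u j.+1 ^+ p * (1 + u j.+1) <= u j ^+ p.
  have h1 : u j.+1 ^+ p * u j.+1 <= (d j.+1 / C) * (s j / D).
    by rewrite hu ler_wpM2l // divr_ge0 // ltW.
  have h2 : (d j.+1 / C) * (s j / D) <= (a j * D / C) * (s j / D).
    rewrite ler_wpM2r ?divr_ge0 ?(ltW D0) // ler_wpM2r ?invr_ge0 ?(ltW C0) //.
  have h3 : (a j * D / C) * (s j / D) = a j * s j / C.
    by field; rewrite !gt_eqF.
  have h4 : a j * s j / C <= d j / C - d j.+1 / C.
    by rewrite -mulrBl ler_wpM2r // invr_ge0 ltW.
  by move: h1; rewrite mulrDr mulr1 !hu; lra.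
have K0 : 0 < k%:R :> R by rewrite ltr0n.
have uk : u k <= (p%:R + 1) * (1 + u 0%N) / k%:R.
  rewrite ler_pdivlMr // mulrC.
  apply: le_trans (@power_recurrence_rate R p u p0 hu0 rec k) _.
  by rewrite ler_wpM2r ?addr_ge0 // lerDl.
have dE : d k = C * u k ^+ p by rewrite hu mulrC divfK ?gt_eqF.
have d0E : d 0%N = C * u 0%N ^+ p by rewrite hu mulrC divfK ?gt_eqF.
rewrite dE d0E.
have -> : 2^-1 * (C + C * u 0%N ^+ p) * ((2 * p + 2)%:R / k%:R) ^+ p =
  C * (2 ^+ p.-1 * (1 + u 0%N ^+ p) * ((p%:R + 1) / k%:R) ^+ p).
  have -> : (2 * p + 2)%:R = 2 * (p%:R + 1) :> R by rewrite natrD natrM; ring.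
  rewrite -mulrA [X in _ = X](_ : _ =
      C * (1 + u 0%N ^+ p) * (2^-1 * (2 ^+ p) * ((p%:R + 1) / k%:R) ^+ p)).
    rewrite -[2 * _ / _]mulrA exprMn; ring.
  have e2 : 2 ^+ p = 2 * 2 ^+ p.-1 :> R by rewrite -exprS prednK.
  by rewrite e2 mulKf ?pnatr_eq0 //; ring.
rewrite ler_pM2l //.
apply: (@le_trans _ _ (((p%:R + 1) * (1 + u 0%N) / k%:R) ^+ p)).
  by rewrite ler_pXn2r // nnegrE // !mulr_ge0 ?invr_ge0 ?addr_ge0 // ltW.
by rewrite mulrAC exprMn mulrC ler_wpM2r // -(prednK p0) exprD1_le.
Qed.

(** * The Euclidean structure and one proximal step *)

Section DualityPairing.
Context {R : realType} {E : finNormedModType R} (B : 'Hom(E, dual E)).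
Hypotheses (Bsym : self_adjoint B) (Bpos : positive_definite B).

Lemma dualZE (k : R) (g : dual E) h : (k *: g) h = k * g h :> R.
Proof. by rewrite scale_lfunE. Qed.

Local Notation "<< x , y >>" := ((B x : dual E) y).

Lemma pairDl x y z : << x + y, z >> = << x, z >> + << y, z >>.
Proof. by rewrite linearD add_lfunE. Qed.

Lemma pairZl k x z : << k *: x, z >> = k * << x, z >>.
Proof. by rewrite linearZ /= dualZE. Qed.

Lemma pairDr x y z : << z, x + y >> = << z, x >> + << z, y >>.
Proof. by rewrite linearD. Qed.

Lemma pairZr k x z : << z, k *: x >> = k * << z, x >>.
Proof. by rewrite linearZ. Qed.

Lemma pair_ge0 x : 0 <= << x, x >>.
Proof. by have [->|/Bpos/ltW//] := eqVneq x 0; rewrite linear0 lexx. Qed.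

Lemma pnorm_ge0 x : 0 <= pnorm B x.
Proof. exact: sqrtr_ge0. Qed.

Lemma sqr_pnorm x : pnorm B x ^+ 2 = << x, x >>.
Proof. exact/sqr_sqrtr/pair_ge0. Qed.

Lemma pnorm_eq0 x : pnorm B x = 0 -> x = 0.
Proof.
move=> h; apply/eqP/negPn/negP => /Bpos.
by rewrite -sqr_pnorm h expr0n ltxx.
Qed.

Lemma sqr_pnormD_scale (k : R) x y :
  pnorm B (x + k *: y) ^+ 2 =
  pnorm B x ^+ 2 + 2 * k * << x, y >> + k ^+ 2 * pnorm B y ^+ 2.
Proof.
rewrite !sqr_pnorm !(pairDl, pairDr, pairZl, pairZr) (Bsym y x); ring.
Qed.

(** Cauchy-Schwarz: the squared norm of x - (|x| / |y|) y equals
    2 (|x| / |y|) (|x| |y| - <Bx, y>). *)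
Lemma pair_le_pnorm x y : << x, y >> <= pnorm B x * pnorm B y.
Proof.
have [y0|yn0] := eqVneq (pnorm B y) 0.
  by rewrite (pnorm_eq0 _ y0) linear0 mulr_ge0 ?pnorm_ge0.
have [x0|xn0] := eqVneq (pnorm B x) 0.
  by rewrite (pnorm_eq0 _ x0) linear0 zero_lfunE mulr_ge0 ?pnorm_ge0.
have hy : 0 < pnorm B y by rewrite lt0r yn0 pnorm_ge0.
have hx : 0 < pnorm B x by rewrite lt0r xn0 pnorm_ge0.
have := sqr_ge0 (pnorm B (x + (- (pnorm B x / pnorm B y)) *: y)).
rewrite sqr_pnormD_scale.
set a := pnorm B x in hx *; set b := pnorm B y in hy yn0 *; set c := << _, _ >>.
have -> : a ^+ 2 + 2 * - (a / b) * c + (- (a / b)) ^+ 2 * b ^+ 2 =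
  2 * (a / b) * (a * b - c) by field.
by rewrite pmulr_rge0 ?subr_ge0 // mulr_gt0 ?divr_gt0.
Qed.

Lemma pairing_map_ker : lker B == 0%VS.
Proof.
apply/lker0P => x y hxy; apply/eqP; rewrite -subr_eq0; apply/negPn/negP=> /Bpos.
by rewrite -[- y]scaleN1r pairDl pairZl hxy mulN1r subrr ltxx.
Qed.

(** Through Riesz representatives, dual norms become norms of vectors
    ([dnorm_pairing_map]). *)
Lemma dual_representative (g : dual E) : exists u, g = B u.
Proof.
have /memv_imgP [u _ ->] : g \in limg B; last by exists u.
suff -> : limg B = fullv by exact: memvf.
apply/eqP; rewrite eqEdim subvf /= limg_dim_eq; last first.
  by rewrite (eqP pairing_map_ker) capv0.
by rewrite !dimvf /dim /= muln1.
Qed.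

Lemma dnorm_pairing_map u : dnorm B (B u : dual E) = pnorm B u.
Proof. by rewrite /dnorm lker0_lfunK // pairing_map_ker. Qed.

(** u represents the subgradient and d is the step. Expanding the square of the
    hypothesis, with l = H |d|^(p-1), gives
    (1 - b^2) |u|^2 + (l |d|)^2 <= - 2 l <Bu, d>. The number s is the length
    at which H s^p = (1 - b) |u|; the step is at least that long, and the
    left-hand side is then at least 2 l |u| s. *)
Lemma prox_step_decrease (p : nat) (H b : R) (u d : E) :
  (0 < p)%N -> 0 < H -> 0 <= b -> b * p%:R <= 1 -> b < 1 ->
  pnorm B (u + (H * pnorm B d ^+ p.-1) *: d) <= b * pnorm B u ->
  exists s, [/\ 0 <= s, H * s ^+ p = (1 - b) * pnorm B u &
    pnorm B u * s <= - << u, d >>].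
Proof.
move=> p0 H0 b0 bp b1 hb.
have [||s s0 hs] := @exists_nth_root R p ((1 - b) * pnorm B u / H) => //.
  by rewrite divr_ge0 ?(ltW H0) // mulr_ge0 ?pnorm_ge0 // subr_ge0 ltW.
have Hs : H * s ^+ p = (1 - b) * pnorm B u by rewrite hs mulrC divfK ?gt_eqF.
exists s; split => //.
have [u0|un0] := eqVneq (pnorm B u) 0.
  by rewrite u0 mul0r (pnorm_eq0 _ u0) linear0 zero_lfunE oppr0.
have a0 : 0 < pnorm B u by rewrite lt0r un0 pnorm_ge0.
set r := pnorm B d in hb; have r0 : 0 <= r by exact: pnorm_ge0.
set l := H * r ^+ p.-1 in hb.
have l0 : 0 <= l by rewrite mulr_ge0 ?exprn_ge0 // ltW.
have hb2 : pnorm B (u + l *: d) ^+ 2 <= (b * pnorm B u) ^+ 2.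
  by rewrite lerXn2r // ?nnegrE ?pnorm_ge0 // mulr_ge0 // pnorm_ge0.
rewrite sqr_pnormD_scale -/r in hb2.
have cs : - << u, d >> <= pnorm B u * r.
  have := pair_le_pnorm (- u) d.
  rewrite -scaleN1r pairZl mulN1r /pnorm pairZl pairZr mulrA mulN1r opprK mul1r.
  exact.
set a := pnorm B u in hb2 cs Hs a0 *; set N := << u, d >> in hb2 cs *.
have lr : (1 - b) * a <= l * r.
  have h : (a - l * r) ^+ 2 <= (b * a) ^+ 2.
    by have := ler_wpM2l l0 cs; nra.
  have : a - l * r <= b * a.
    rewrite (le_trans (ler_norm _)) // -(@ler_pXn2r _ 2) ?nnegrE //.
      by rewrite real_normK ?num_real.
    by rewrite mulr_ge0 // ltW.
  lra.
have lrE : l * r = H * r ^+ p by rewrite /l -mulrA -exprSr prednK.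
have s_gt0 : 0 < s.
  rewrite lt0r s0 andbT; apply: contraTneq a0 => sz.
  move: Hs; rewrite sz expr0n gtn_eqF // mulr0 => /esym/eqP.
  by rewrite mulf_eq0 subr_eq0 gt_eqF //= => /eqP ->; rewrite ltxx.
have sr : s <= r.
  by rewrite -(@ler_pXn2r _ p) ?nnegrE // -(ler_pM2l H0) Hs -lrE.
(* From here on, lengths are expressed through t >= 1. *)
pose t := r / s.
have t1 : 1 <= t by rewrite ler_pdivlMr // mul1r.
have rE : r = t * s by rewrite divfK ?gt_eqF.
have l_gt0 : 0 < l by rewrite mulr_gt0 // exprn_gt0 // (lt_le_trans s_gt0).
have lrt : l * r = (1 - b) * a * t ^+ p.
  by rewrite lrE rE exprMn mulrCA Hs mulrC.
have lst : l * s = (1 - b) * a * t ^+ p.-1.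
  have : l * s * t = (1 - b) * a * t ^+ p.-1 * t.
    by rewrite -[RHS]mulrA -exprSr prednK // -lrt rE; ring.
  by move/mulIf; apply; rewrite gt_eqF // (lt_le_trans ltr01).
have main := @prox_scalar_ge R t b p.-1 t1.
rewrite prednK // in main; have {main}main := main bp.
rewrite exprD in main.
have h2 : 2 * l * (a * s) <= 2 * l * - N.
  have -> : 2 * l * (a * s) = (1 - b) * a ^+ 2 * (2 * t ^+ p.-1).
    by rewrite -mulrA [l * _]mulrCA lst; ring.
  have k0 : 0 <= (1 - b) * a ^+ 2 by rewrite mulr_ge0 ?sqr_ge0 ?subr_ge0 ?ltW.
  apply: le_trans (ler_wpM2l k0 main) _.
  have -> : (1 - b) * a ^+ 2 * (1 + b + (1 - b) * (t ^+ p * t ^+ p)) =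
     (1 - b ^+ 2) * a ^+ 2 + (l * r) ^+ 2 by rewrite lrt; ring.
  rewrite exprMn; move: hb2; rewrite exprMn; lra.
by move: h2; rewrite ler_pM2l // mulr_gt0.
Qed.

End DualityPairing.

(** * Linear functionals in finite dimension *)

Section FiniteDimension.
Context {R : realType} {E : finNormedModType R}.

(** The norm of E, seen as a function of the coordinates, is continuous and
    positive on the compact unit sphere of the sup norm, hence at least some
    m > 0 there; by homogeneity, coordinates are bounded by m^-1 times the
    norm. *)
Lemma coord_bounded :
  exists2 k : R, 0 <= k & forall (x : E) i, `|v2r x ord0 i| <= k * `|x|.
Proof.
pose n := dim E; pose phi (c : 'rV[R]_n) : E := @r2v R E c.
pose M := \sum_(i < n) `|phi (delta_mx 0 i)|.
have phi_le c : `|phi c| <= M * `|c|.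
  rewrite /phi {1}(row_sum_delta c) linear_sum /= mulr_suml.
  apply: le_trans (ler_norm_sum _ _ _) _; apply: ler_sum => i _.
  rewrite linearZ normrZ mulrC ler_wpM2l // [`|c|]mx_normrE.
  by rewrite (le_bigmax_cond _ (fun j => `|c j.1 j.2|) (isT : xpredT (0, i))).
have phic : continuous (fun c => `|phi c|).
  have phiL : continuous (r2v : {linear 'rV[R]_(dim E) -> E}).
    apply: bounded_linear_continuous; apply/linear_boundedP; near=> r => c.
    apply: le_trans (phi_le c) _; rewrite ler_wpM2r //.
  by move=> c; apply: (continuous_comp (phiL c)); exact: norm_continuous.
pose S := [set c : 'rV[R]_n | `|c| = 1].
have Scpt : compact S.
  apply: bounded_closed_compact.
    by exists 1; split => // z z1 c /= ->; exact: ltW.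
  rewrite (_ : S = (fun c : 'rV[R]_n => `|c|) @^-1` [set 1]) //.
  apply: closed_comp; first by move=> c _; exact: norm_continuous.
  exact: closed_eq.
have [m m0 hm] : exists2 m : R, 0 < m & forall c, S c -> m <= `|phi c|.
  (* In dimension 0 the sphere is empty and any m will do. *)
  have [S0|nS0] := pselect (S !=set0); last first.
    by exists 1 => // c Sc; case: nS0; exists c.
  have [c0 Sc0 hc0] := @EVT_min_rV R n _ S S0 Scpt
    (continuous_subspaceT phic).
  exists `|phi c0|; last by move=> c Sc; apply: hc0; rewrite inE.
  rewrite normr_gt0; apply/eqP => phi0; move: Sc0; rewrite inE /S /=.
  have -> : c0 = 0 by apply: (can_inj r2vK); rewrite -/(phi c0) phi0 linear0.
  by rewrite normr0 => /esym/eqP; rewrite oner_eq0.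
exists m^-1 => [|x i]; first by rewrite invr_ge0 ltW.
set c := v2r x; apply: (@le_trans _ _ `|c|).
  rewrite [`|c|]mx_normrE.
  by rewrite (le_bigmax_cond _ (fun j => `|c j.1 j.2|) (isT : xpredT (0, i))).
have [c0|cn0] := eqVneq c 0.
  by rewrite c0 normr0 mulr_ge0 // invr_ge0 ltW.
have cgt : 0 < `|c| by rewrite normr_gt0.
have : S (`|c|^-1 *: c).
  by rewrite /S /= normrZ gtr0_norm ?invr_gt0 // mulVf ?gt_eqF.
have -> : `|x| = `|phi c| by rewrite /phi /c v2rK.
move=> /hm; rewrite {1}/phi linearZ normrZ gtr0_norm ?invr_gt0 //= -/(phi c).
by rewrite ler_pdivlMl // mulrC ler_pdivlMl.
Unshelve. all: by end_near. Qed.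

Lemma linear_functional_bounded (f : {linear E -> R}) :
  exists2 C : R, 0 <= C & forall x, `|f x| <= C * `|x|.
Proof.
have [k k0 hk] := coord_bounded.
exists (\sum_(i < dim E) k * `|f (r2v (delta_mx 0 i))|) => [|x].
  by apply: sumr_ge0 => i _; rewrite mulr_ge0.
rewrite -{1}(v2rK x) (row_sum_delta (v2r x)) !linear_sum /= mulr_suml.
apply: le_trans (ler_norm_sum _ _ _) _; apply: ler_sum => i _.
rewrite !linearZ normrM mulrAC ler_wpM2r //; exact: hk.
Qed.

(** Compares the Euclidean norm of B with the norm that carries the
    topology. *)
Lemma bilinear_diag_bounded (B : 'Hom(E, dual E)) :
  exists2 C : R, 0 <= C & forall x, `|(B x : dual E) x| <= C * `|x| ^+ 2.
Proof.
have [k k0 hk] := coord_bounded.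
have hC i : exists C : R, 0 <= C /\
    forall x, `|(B (r2v (delta_mx 0 i)) : dual E) x| <= C * `|x|.
  have [C C0 hC] := linear_functional_bounded (B (r2v (delta_mx 0 i)) : dual E).
  by exists C.
have [C hC'] := choice hC.
exists (\sum_(i < dim E) k * C i) => [|x].
  by apply: sumr_ge0 => i _; rewrite mulr_ge0 //; have [] := hC' i.
rewrite -{1}(v2rK x) (row_sum_delta (v2r x)) !linear_sum /= mulr_suml.
rewrite sum_lfunE; apply: le_trans (ler_norm_sum _ _ _) _.
apply: ler_sum => i _; have [_ hi] := hC' i.
rewrite !linearZ /= scale_lfunE normrM expr2 mulrACA ler_pM //.
Qed.

Lemma linear_functional_continuous (f : {linear E -> R}) : continuous f.
Proof.
have [C C0 hC] := linear_functional_bounded f.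
apply: bounded_linear_continuous; apply/linear_boundedP; near=> r => x.
by apply: le_trans (hC x) _; rewrite ler_wpM2r.
Unshelve. all: by end_near. Qed.

End FiniteDimension.

(** * Gradients *)

Section Gradient.
Context {R : realType} {E : finNormedModType R}.
(** The difference quotients of f along y - x at a parameter h in ]0, 1] are at
    most f y - f x, and so is their limit. *)
Lemma convex_gradient_le (f : E -> R) (x y : E) :
  convex_function setT f -> differentiable f x ->
  f x + 'd f x (y - x) <= f y.
Proof.
move=> fconv fd; rewrite -lerBrDl -deriveE //.
have /cvg_ex[l hl] : derivable f x (y - x) by exact: diff_derivable.
rewrite /derive (cvg_lim _ hl) //.
have hr := @cvg_dnbhs_at_right R _ _ _ _ hl.
rewrite -(cvg_lim _ hr) //; apply: limr_le; first by apply/cvg_ex; exists l.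
near=> h.
have h0 : 0 < h by near: h; exact: nbhs_right_gt.
have h1 : h <= 1 by near: h; exact: nbhs_right_le.
have c : f (h *: y + (1 - h) *: x) <= h * f y + (1 - h) * f x.
  by have := fconv (Itv01 (ltW h0) h1) y x; rewrite !inE; apply.
rewrite /= [_ *: _]/(_ * _) ler_pdivrMl // mulrBr.
have -> : h *: (y - x) + x = h *: y + (1 - h) *: x.
  by rewrite scalerBr scalerBl scale1r addrAC addrA.
lra.
Unshelve. all: by end_near. Qed.

Lemma is_diff_quadratic_remainder (f : E -> R) (L : {linear E -> R}) (C : R) x :
  (\forall h \near (0 : E), `|f (h + x) - f x - L h| <= C * `|h| ^+ 2) ->
  is_diff x f L.
Proof.
move=> hC.
have hd : f \o shift x = cst (f x) + L +o_ (0 : E) id.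
  apply/eqaddoP => e e0.
  have C1 : 0 < `|C| + 1 by rewrite ltr_wpDl.
  near=> h.
  have hb : `|f (h + x) - f x - L h| <= C * `|h| ^+ 2 by near: h.
  rewrite /= !fctE /= opprD addrA; apply: le_trans hb _.
  rewrite expr2 mulrA ler_wpM2r //.
  apply: (@le_trans _ _ ((`|C| + 1) * `|h|)).
    by rewrite ler_wpM2r // (le_trans (ler_norm C)) // lerDl.
  rewrite -ler_pdivlMl //; near: h; apply: nbhs0_le.
  by rewrite mulr_gt0 ?invr_gt0.
have Lc : continuous L by exact: linear_functional_continuous.
have dL := diff_unique Lc hd.
split=> //; apply/diff_locallyP; rewrite dL; split => //.
Unshelve. all: by end_near. Qed.

Variable B : 'Hom(E, dual E).
Hypotheses (Bsym : self_adjoint B) (Bpos : positive_definite B).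

Lemma is_diff_sqr_pnorm (x : E) :
  is_diff x (fun y => pnorm B y ^+ 2) (2 *: (B x : dual E)).
Proof.
have [C C0 hC] := bilinear_diag_bounded B.
apply: (@is_diff_quadratic_remainder _ _ C); near=> h.
suff -> : pnorm B (h + x) ^+ 2 - pnorm B x ^+ 2 - (2 *: (B x : dual E)) h =
  (B h : dual E) h by exact: hC.
have := sqr_pnormD_scale _ Bsym Bpos 1 x h.
rewrite scale1r dualZE [h + x]addrC => ->.
rewrite (sqr_pnorm _ Bpos h); ring.
Unshelve. all: by end_near. Qed.

(** Away from 0, the chain rule applies, and the derivative of the norm is read
    off from that of its square. At 0 the exponent m + 2 >= 2 makes the
    function O(|h|^2), so its derivative vanishes there. *)
Lemma is_diff_pnorm_expr (m : nat) (x : E) :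
  is_diff x (fun y => pnorm B y ^+ m.+2)
    ((m.+2%:R * pnorm B x ^+ m) *: (B x : dual E)).
Proof.
have [->|xn0] := eqVneq x 0.
  have [C C0 hC] := bilinear_diag_bounded B.
  apply: (@is_diff_quadratic_remainder _ _ C).
  have P0 : pnorm B 0 = 0 by rewrite /pnorm linear0 sqrtr0.
  near=> h; have B0 : (B 0 : dual E) h = 0 by rewrite linear0 zero_lfunE.
  rewrite addr0 P0 /= dualZE B0 mulr0 subr0 expr0n subr0.
  rewrite -addn2 exprD (sqr_pnorm _ Bpos h) normrM.
  rewrite -[leRHS]mul1r ler_pM //.
  rewrite ger0_norm ?exprn_ge0 ?pnorm_ge0 // exprn_ile1 ?pnorm_ge0 //.
  rewrite -(@ler_pXn2r _ 2) ?nnegrE ?pnorm_ge0 // expr1n (sqr_pnorm _ Bpos h).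
  apply: le_trans (ler_norm _) _; apply: le_trans (hC h) _.
  (* For such h, C |h|^2 <= 1, so the factor pnorm B h ^+ m is at most 1. *)
  have h1 : `|h| <= Num.min 1 (C + 1)^-1.
    near: h; apply: nbhs0_le; rewrite lt_min ltr01 invr_gt0; lra.
  move: h1; rewrite le_min => /andP[h1 h2].
  have C1 : 0 < C + 1 by lra.
  move: h2; rewrite -[_^-1]mulr1 ler_pdivlMl // => h2.
  have := normr_ge0 h; nra.
have r0 : 0 < pnorm B x.
  by rewrite lt0r pnorm_ge0 andbT; apply: contra_neq xn0; exact: pnorm_eq0.
have dQ := is_diff_sqr_pnorm x.
have Q0 : 0 < pnorm B x ^+ 2 by rewrite exprn_gt0.
have ds := is_derive1_sqrt Q0.
have dr : differentiable (pnorm B) x.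
  rewrite (_ : pnorm B = Num.sqrt \o (fun y => pnorm B y ^+ 2)); last first.
    by apply/funext => y /=; rewrite sqrtr_sqr ger0_norm // pnorm_ge0.
  apply: differentiable_comp => //.
  by apply/derivable1_diffP; case: ds.
have dr' := differentiableP dr.
have e2 : 'd (pnorm B) x = (pnorm B x)^-1 *: (B x : dual E) :> (E -> R).
  have e : (2 *: (B x : dual E) : E -> R) =
           2%:R * pnorm B x ^+ 1 *: ('d (pnorm B) x : E -> R).
    rewrite -(@diff_val _ _ _ _ _ _ _ dQ).
    exact: (@diff_val _ _ _ _ _ _ _ (is_diffX 1 dr')).
  apply/funext => h; rewrite !dualZE.
  have eh : 2 * (B x : dual E) h = 2 * pnorm B x * 'd (pnorm B) x h.
    by rewrite -dualZE; have := congr1 (fun g => g h) e; rewrite expr1; exact.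
  have n2 : 2 != 0 :> R by rewrite pnatr_eq0.
  move: eh; rewrite -mulrA => /(mulfI n2) ->.
  by rewrite mulKf // gt_eqF.
rewrite (_ : (fun y => _) = pnorm B ^+ m.+2); last by rewrite exprfctE.
apply: (is_diff_eq (is_diffX m.+1 dr')).
apply/funext => h; rewrite dualZE.
transitivity (m.+2%:R * pnorm B x ^+ m.+1 * 'd (pnorm B) x h) => //.
by rewrite e2 dualZE exprSr; field; rewrite gt_eqF.
Unshelve. all: by end_near. Qed.

Lemma grad_reg_fun (f : E -> R) (m : nat) (H : R) (c x : E) :
  differentiable f x ->
  grad (reg_fun B f m.+1 H c) x =
  grad f x + (B ((H * pnorm B (x - c) ^+ m) *: (x - c)) : dual E).
Proof.
move=> fd; have df := differentiableP fd.
have dc : is_diff x (fun z : E => z - c) id.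
  apply: (@is_diff_eq _ _ _ _ _ _ _
    (is_diffB (is_diff_id x) (is_diff_cst c x))).
  by apply/funext => h; rewrite !fctE subr0.
have dp := is_diff_pnorm_expr m (x - c).
have dpc := is_diff_comp dc dp.
have dreg : is_diff x (reg_fun B f m.+1 H c) (fun h =>
    'd f x h + H * pnorm B (x - c) ^+ m * (B (x - c) : dual E) h).
  rewrite (_ : reg_fun B f m.+1 H c = f + (H * m.+2%:R^-1) *:
      ((fun y => pnorm B y ^+ m.+2) \o (fun z => z - c))); last first.
    by apply/funext => z; rewrite /reg_fun /prox_fun mulrA.
  apply: (is_diff_eq (is_diffD df (is_diffZ (H * m.+2%:R^-1) dpc))).
  apply/funext => h; transitivity ('d f x h + H / m.+2%:R *
    (((m.+2%:R * pnorm B (x - c) ^+ m) *: (B (x - c) : dual E)) h)) => //.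
  rewrite dualZE; congr (_ + _).
  have : m.+2%:R != 0 :> R by rewrite pnatr_eq0.
  by set n := m.+2%:R => n0; field.
apply/lfunP => h; rewrite add_lfunE /grad !lfunE /=.
rewrite (@diff_val _ _ _ _ _ _ _ dreg).
by rewrite linearZ /= dualZE.
Qed.

End Gradient.

(** * The composite objective *)

Section CompositeObjective.
Context {R : realType} {E : finNormedModType R}.
Variables (f : E -> R) (psi : E -> \bar R).

(** Finite-valued form of [objective], meaningful on the domain of psi. *)
Definition fobjective (y : E) : R := f y + fine (psi y).

Lemma objectiveE y : proper_fun psi -> edom psi y ->
  objective f psi y = (fobjective y)%:E.
Proof.
move=> [psiNy _] ydom; rewrite /objective /fobjective EFinD fineK //.
by rewrite fin_numE psiNy /= -ltey.
Qed.

Lemma objective_subgradient (g : dual E) z y :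
  convex_function setT f -> differentiable f z -> proper_fun psi ->
  edom psi z -> edom psi y -> subdiff psi z g ->
  fobjective z + (grad f z + g) (y - z) <= fobjective y.
Proof.
move=> fconv fd psip zdom ydom zg.
have fin t : edom psi t -> (fine (psi t))%:E = psi t.
  by move=> td; rewrite fineK // fin_numE psip.1 /= -ltey.
have := zg y; rewrite -(fin _ zdom) -(fin _ ydom) -EFinD lee_fin => hpsi.
have hf := convex_gradient_le f z y fconv fd.
by rewrite add_lfunE /grad lfunE /= /fobjective; lra.
Qed.

End CompositeObjective.

(** The supremum is nonnegative because x0 belongs to its own level set; being
    below +oo, it is a real number. *)
Lemma level_radius_ge (R : realType) (E : finNormedModType R)
  (B : 'Hom(E, dual E)) (f : E -> R) (psi : E -> \bar R) (xs x0 : E) :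
  edom psi x0 -> (level_radius B f psi xs x0 < +oo)%E ->
  exists D, [/\ level_radius B f psi xs x0 = D%:E, 0 <= D &
    forall y, edom psi y -> (objective f psi y <= objective f psi x0)%E ->
      pnorm B (y - xs) <= D].
Proof.
move=> x0dom; set L := level_radius _ _ _ _ _ => Lfin.
have ub y : edom psi y -> (objective f psi y <= objective f psi x0)%E ->
    ((pnorm B (y - xs))%:E <= L)%E.
  by move=> yd yl; apply: ereal_sup_ubound; exists y.
have L0 : (0%:E <= L)%E.
  by apply: le_trans (ub x0 x0dom (lexx _)); rewrite lee_fin pnorm_ge0.
have LE : L = (fine L)%:E by rewrite fineK // ge0_fin_numE.
exists (fine L); split => //; first by rewrite -lee_fin -LE.
by move=> y yd yl; rewrite -lee_fin -LE ub.
Qed.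

(** * The rate of the inexact proximal-point method *)

Theorem theorem2p6 (R : realType) (E : finNormedModType R)
  (B : 'Hom(E, dual E)) (f : E -> R) (psi : E -> \bar R) (xs : E)
  (p : nat) (H beta : R) (x : nat -> E) :
  self_adjoint B -> positive_definite B ->
  convex_function setT f -> (forall y : E, differentiable f y) ->
  proper_fun psi -> closed_fun psi -> convex_efun psi ->
  edom psi xs ->
  (forall y : E, edom psi y -> (objective f psi xs <= objective f psi y)%E) ->
  (1 <= p)%N -> 0 < H -> 0 <= beta <= p%:R^-1 -> beta < 1 ->
  edom psi (x 0%N) ->
  (forall k : nat, exists g : dual E,
     acceptable B f psi p H (x k) beta (x k.+1, g)) ->
  (level_radius B f psi xs (x 0%N) < +oo)%E ->
  forall k : nat, (1 <= k)%N ->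
  (objective f psi (x k) - objective f psi xs <=
   2^-1%:E *
   ((1 - beta)^-1%:E * H%:E * level_radius B f psi xs (x 0%N) ^+ p.+1
      + objective f psi (x 0%N) - objective f psi xs) *
   (((2 * p + 2)%:R / k%:R) ^+ p)%:E)%E.
Proof.
move=> Bsym Bpos fconv fd psip _ _ xsdom xsmin p0 H0 /andP[b0 bp] b1 x0dom acc
  Lfin.
have bp1 : beta * p%:R <= 1 by rewrite -ler_pdivlMr ?ltr0n // mul1r.
have xdom k : edom psi (x k) by case: k => // k; have [g []] := acc k.
have [D [DE D0 Dub]] := level_radius_ge _ _ _ _ _ _ _ x0dom Lfin.
pose F := fobjective f psi.
have FE y : edom psi y -> objective f psi y = (F y)%:E.
  exact: objectiveE.
have step k : exists us : E * R, [/\ 0 <= us.2,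
    H * us.2 ^+ p = (1 - beta) * pnorm B us.1,
    pnorm B us.1 * us.2 <= - (B us.1 : dual E) (x k.+1 - x k) &
    forall y, edom psi y ->
      F (x k.+1) + (B us.1 : dual E) (y - x k.+1) <= F y].
  have [g [/= _ gsub]] := acc k.
  have [u uE] := dual_representative _ Bpos (grad f (x k.+1) + g).
  (* Acceptability, stated for the Riesz representatives. *)
  rewrite uE -{1}(prednK p0) grad_reg_fun // addrAC uE -linearD.
  rewrite !dnorm_pairing_map // => hu.
  have [s [s0 hs us]] :=
    prox_step_decrease _ Bsym Bpos p H beta u _ p0 H0 b0 bp1 b1 hu.
  exists (u, s); split => //= y ydom.
  by rewrite -uE; exact: objective_subgradient.
have [us hus] := choice step.
pose a k := pnorm B (us k).1; pose s k := (us k).2.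
have dec k : a k * s k <= F (x k) - F (x k.+1).
  have [_ _ h1 h2] := hus k; have := h2 _ (xdom k).
  rewrite -[x k - _]opprB linearN; move: h1; rewrite -/(a k) -/(s k).
  set N := (B _ : dual E) _; lra.
have s0 k : 0 <= s k by have [] := hus k.
have a0 k : 0 <= a k by exact: pnorm_ge0.
have mono k : F (x k) <= F (x 0%N).
  elim: k => // k; apply: le_trans.
  by rewrite -subr_ge0; apply: le_trans (dec k); exact: mulr_ge0.
have gap k : F (x k.+1) - F xs <= a k * D.
  have [_ _ _ h2] := hus k; have := h2 _ xsdom.
  have cs := pair_le_pnorm _ Bsym Bpos (us k).1 (x k.+1 - xs).
  have r : pnorm B (x k.+1 - xs) <= D.
    by apply: Dub => //; rewrite !FE // lee_fin.
  have := ler_wpM2l (a0 k) r; rewrite -/(a k) in cs.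
  rewrite -[xs - _]opprB linearN; move: cs; set N := (B _ : dual E) _; lra.
move=> k k0; rewrite !FE // DE.
rewrite -EFin_expe -!EFinM -!(EFinM, EFinD, EFinB) lee_fin.
rewrite -addrA.
apply: (inexact_descent_rate R p H beta D (fun j => F (x j) - F xs) a s) => //.
  by move=> j; rewrite subr_ge0 -lee_fin -!FE //; exact: xsmin.
- by move=> j; have [] := hus j.
by move=> j; have := dec j; lra.
Qed.
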